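(* Let $t>0$. A point $x\in\mathbb{R}^n$ is a Karush-Kuhn-Tucker point of the Kanzow-Schwartz regularization $\text{KS}(t)$ if and only if it is an S-stationary point of the disjunctive regularization $\text{D}(t)$.
   Context: Let $f\in C^2(\mathbb{R}^n,\mathbb{R})$, $F_1,F_2\in C^2(\mathbb{R}^n,\mathbb{R}^\kappa)$, $t>0$. The Kanzow-Schwartz regularization $\text{KS}(t)$ is the nonlinear program $\min f(x)$ s.t. $x\in M^{\text{KS}(t)}$ with $M^{\text{KS}(t)}=\{x\in\mathbb{R}^n\mid\Phi_j(x,t)\le 0,\ F_{1,j}(x)\ge 0,\ F_{2,j}(x)\ge 0,\ j=1,\ldots,\kappa\}$, where $\Phi_j(x,t)=\varphi(F_{1,j}(x)-t,F_{2,j}(x)-t)$ and $\varphi(a,b)=a\cdot b$ for $a+b\ge 0$, $\varphi(a,b)=-\frac12(a^2+b^2)$ for $a+b<0$ (the function $\varphi$ is continuously differentiable). A point $x\in M^{\text{KS}(t)}$ is a Karush-Kuhn-Tucker point of $\text{KS}(t)$ if there exist $\mu_j,\mu_{1,j},\mu_{2,j}\ge 0$, $j=1,\ldots,\kappa$, with $$\nabla f(x)=-\sum_{j=1}^\kappa\mu_j\nabla\Phi_j(x,t)+\sum_{j=1}^\kappa\mu_{1,j}\nabla F_{1,j}(x)+\sum_{j=1}^\kappa\mu_{2,j}\nabla F_{2,j}(x)$$ ($\nabla\Phi_j$ being the gradient with respect to $x$) and $\mu_j\Phi_j(x,t)=0$, $\mu_{1,j}F_{1,j}(x)=0$, $\mu_{2,j}F_{2,j}(x)=0$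 for all $j$. The disjunctive regularization $\text{D}(t)$ is the problem $\min f(x)$ s.t. $x\in M^{\text{D}(t)}$ with $M^{\text{D}(t)}=\{x\in\mathbb{R}^n \mid \max\{t-F_{1,j}(x),t-F_{2,j}(x)\}\ge 0,\ F_{1,j}(x)\ge 0,\ F_{2,j}(x)\ge 0,\ j=1,\ldots,\kappa\}$. For $x\in M^{\text{D}(t)}$: $\mathcal{H}_{12}(x)=\{j\mid F_{1,j}(x)=F_{2,j}(x)=t\}$, $\mathcal{H}_{1}(x)=\{j\mid F_{1,j}(x)=t,F_{2,j}(x)>t\}$, $\mathcal{H}_{2}(x)=\{j\mid F_{1,j}(x)>t,F_{2,j}(x)=t\}$, $\mathcal{N}_1(x)=\{j\mid F_{1,j}(x)=0\}$, $\mathcal{N}_2(x)=\{j\mid F_{2,j}(x)=0\}$. $x\in M^{\text{D}(t)}$ is S-stationary for $\text{D}(t)$ if there exist multipliers $\zeta_{1,j}=\zeta_{2,j}=0$ ($j\in\mathcal{H}_{12}(x)$), $\eta_{1,j}\ge 0$ ($j\in\mathcal{H}_1(x)$), $\eta_{2,j}\ge 0$ ($j\in\mathcal{H}_2(x)$), $\nu_{1,j}\ge 0$ ($j\in\mathcal{N}_1(x)$), $\nu_{2,j}\ge 0$ ($j\in\mathcal{N}_2(x)$) with $$\nabla f(x)=-\sum_{j\in\mathcal{H}_{12}(x)}\left(\zeta_{1,j}\nabla F_{1,j}(x)+\zeta_{2,j}\nabla F_{2,j}(x)\right)-\sum_{j\in\mathcal{H}_1(x)}\eta_{1,j}\nabla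 F_{1,j}(x)-\sum_{j\in\mathcal{H}_2(x)}\eta_{2,j}\nabla F_{2,j}(x)+\sum_{j\in\mathcal{N}_1(x)}\nu_{1,j}\nabla F_{1,j}(x)+\sum_{j\in\mathcal{N}_2(x)}\nu_{2,j}\nabla F_{2,j}(x).$$ *)

(* Defs.v *)
From mathcomp Require Export all_boot all_order all_algebra.
From mathcomp Require Export all_classical all_reals all_analysis.
Export Order.TTheory GRing.Theory Num.Theory.
Export numFieldNormedType.Exports.

Set Implicit Arguments.
Unset Strict Implicit.
Unset Printing Implicit Defensive.

Local Open Scope ring_scope.

(* C^k in the Fréchet sense.  Since the domain is finite-dimensional, the
   derivative x |-> Df(x) is C^k iff x |-> Df(x)v = 'D_v f x is C^k for every
   direction v. *)
Fixpoint Ck (R : realType) (n : nat) (W : normedModType R) (k : nat)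
    (f : 'rV[R]_n -> W) : Prop :=
  if k is k'.+1 then
    (forall x, differentiable f x) /\ (forall v, Ck k' ('D_v f))
  else continuous f.

Definition grad (R : realType) (n : nat) (g : 'rV[R]_n -> R)
    (x : 'rV[R]_n) : 'rV[R]_n :=
  \row_(i < n) 'D_(delta_mx 0 i) g x.

Definition component (R : realType) (n kappa : nat)
    (F : 'rV[R]_n -> 'rV[R]_kappa) (j : 'I_kappa) (x : 'rV[R]_n) : R :=
  F x 0 j.

Section KanzowSchwartz.
Context (R : realType) (n kappa : nat).
Variables (f : 'rV[R]_n -> R) (F1 F2 : 'rV[R]_n -> 'rV[R]_kappa) (t : R).

Definition varphi (a b : R) : R :=
  if 0 <= a + b then a * b else - (2^-1 * (a ^+ 2 + b ^+ 2)).

Definition Phi (j : 'I_kappa) (x : 'rV[R]_n) : R :=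
  varphi (component F1 j x - t) (component F2 j x - t).

Definition KS_feasible : set 'rV[R]_n :=
  [set x | forall j, [/\ Phi j x <= 0,
                         0 <= component F1 j x & 0 <= component F2 j x]]%classic.

Definition KS_KKT (x : 'rV[R]_n) : Prop :=
  KS_feasible x /\
  exists mu mu1 mu2 : 'I_kappa -> R,
    [/\ forall j, [/\ 0 <= mu j, 0 <= mu1 j & 0 <= mu2 j],
        grad f x = - (\sum_j mu j *: grad (Phi j) x)
                   + \sum_j mu1 j *: grad (component F1 j) x
                   + \sum_j mu2 j *: grad (component F2 j) x
      & forall j, [/\ mu j * Phi j x = 0,
                      mu1 j * component F1 j x = 0
                    & mu2 j * component F2 j x = 0]].

End KanzowSchwartz.

Section Disjunctive.
Context (R : realType) (n kappa : nat).
Variables (f : 'rV[R]_n -> R) (F1 F2 : 'rV[R]_n -> 'rV[R]_kappa) (t : R).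

Definition D_feasible : set 'rV[R]_n :=
  [set x | forall j,
     [/\ 0 <= Num.max (t - component F1 j x) (t - component F2 j x),
         0 <= component F1 j x & 0 <= component F2 j x]]%classic.

Definition H12 (x : 'rV[R]_n) : {set 'I_kappa} :=
  [set j | (component F1 j x == t) && (component F2 j x == t)]%SET.

Definition H1 (x : 'rV[R]_n) : {set 'I_kappa} :=
  [set j | (component F1 j x == t) && (t < component F2 j x)]%SET.

Definition H2 (x : 'rV[R]_n) : {set 'I_kappa} :=
  [set j | (t < component F1 j x) && (component F2 j x == t)]%SET.

Definition N1 (x : 'rV[R]_n) : {set 'I_kappa} :=
  [set j | component F1 j x == 0]%SET.

Definition N2 (x : 'rV[R]_n) : {set 'I_kappa} :=
  [set j | component F2 j x == 0]%SET.

(* Multipliers are total on 'I_kappa; their values off the indicated index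
   sets are unconstrained and never used. *)
Definition D_S_stationary (x : 'rV[R]_n) : Prop :=
  D_feasible x /\
  exists zeta1 zeta2 eta1 eta2 nu1 nu2 : 'I_kappa -> R,
    [/\ forall j, j \in H12 x -> zeta1 j = 0 /\ zeta2 j = 0,
        (forall j, j \in H1 x -> 0 <= eta1 j) /\
        (forall j, j \in H2 x -> 0 <= eta2 j),
        (forall j, j \in N1 x -> 0 <= nu1 j) /\
        (forall j, j \in N2 x -> 0 <= nu2 j)
      & grad f x =
          - (\sum_(j in H12 x) (zeta1 j *: grad (component F1 j) x
                                + zeta2 j *: grad (component F2 j) x))
          - (\sum_(j in H1 x) eta1 j *: grad (component F1 j) x)
          - (\sum_(j in H2 x) eta2 j *: grad (component F2 j) x)
          + \sum_(j in N1 x) nu1 j *: grad (component F1 j) x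
          + \sum_(j in N2 x) nu2 j *: grad (component F2 j) x].

End Disjunctive.

(* Main.v *)
Require Import Defs.
From mathcomp Require Import ring lra.

(** [varphi] vanishes exactly on the boundary of [{min (a, b) <= 0}], where its
    gradient [(b, a)] has nonnegative entries of which at most one is nonzero.
    Hence a KKT multiplier [mu j] of an active constraint [Phi j] corresponds to
    the S-stationarity multiplier [mu j * (F2 j x - t)] on [H1] or
    [mu j * (F1 j x - t)] on [H2], and it contributes nothing on [H12]. *)

Set Implicit Arguments.
Unset Strict Implicit.
Unset Printing Implicit Defensive.

Local Open Scope ring_scope.

(** The difference quotient of [u] at step [h] is at most [|h| * q h ^ 2] in absolute value, where
    the difference quotient [q] of [g] converges, so it is squeezed to 0. *)
Lemma is_derive0_sqr_bound (R : realType) (V : normedModType R)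
    (u g : V -> R) (x v : V) :
  derivable g x v -> (forall y, `|u y| <= (g y - g x) ^+ 2) ->
  is_derive x v u 0.
Proof.
move=> dg ub.
have ux0 : u x = 0.
  by apply/eqP; rewrite -normr_le0 (le_trans (ub x)) // subrr expr0n.
suff cu : (h^-1 *: ((u \o shift x) (h *: v) - u x) @[h --> 0^'] --> (0 : R))%classic.
  apply: DeriveDef; first by apply/cvg_ex; exists 0.
  exact: cvg_lim cu.
pose q (h : R) := h^-1 *: ((g \o shift x) (h *: v) - g x).
have cq : (q h @[h --> 0^'] --> 'D_v g x)%classic by exact: dg.
have ch : ((h : R) @[h --> 0^'] --> (0 : R))%classic.
  exact: cvg_within.
apply: norm_cvg0.
have cr : (`|h| * (q h * q h) @[h --> 0^'] --> (0 : R))%classic.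
  rewrite -[X in (_ --> X)%classic](mul0r ('D_v g x * 'D_v g x)).
  apply: cvgM; last exact: cvgM.
  by rewrite -[X in (_ --> X)%classic](normr0 R); exact: cvg_norm.
apply: (squeeze_cvgr _ (cvg_cst 0) cr).
near=> h; rewrite normr_ge0 ux0 subr0 /=.
have h0 : h != 0 by near: h; exact: nbhs_dnbhs_neq.
apply: (@le_trans _ _ (`|h|^-1 * (g (h *: v + x) - g x) ^+ 2)).
  by rewrite normrM normfV ler_wpM2l ?invr_ge0.
rewrite /q /=; set d := g (h *: v + x) - g x.
rewrite -[h^-1 *: d]/(h^-1 * d).
suff -> : `|h| * (h^-1 * d * (h^-1 * d)) = `|h|^-1 * d ^+ 2 by [].
have h2 : h^-1 * h^-1 = `|h|^-1 * `|h|^-1.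
  by rewrite -!invfM -!expr2 real_normK ?num_real.
rewrite [LHS](_ : _ = `|h| * (h^-1 * h^-1) * d ^+ 2); last by ring.
by rewrite h2 !mulrA divff ?normr_eq0 // mul1r.
Unshelve. all: by end_near.
Qed.

Lemma derivable_component (R : realType) (n kappa : nat)
    (F : 'rV[R]_n -> 'rV[R]_kappa) (x v : 'rV[R]_n) (j : 'I_kappa) :
  differentiable F x -> derivable (component F j) x v.
Proof. by move=> /diff_derivable - /(_ v) /derivable_mxP - /(_ 0 j). Qed.

(** This makes the two feasible sets equal. If [a + b < 0], both sides hold; otherwise a positive
    product would need [a] and [b] both positive. *)
Lemma varphi_le0 (R : realType) (a b : R) :
  (varphi a b <= 0) = (0 <= Num.max (- a) (- b)).
Proof.
rewrite /varphi le_max !oppr_ge0; case: ifPn => [ab|].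
  apply/idP/orP => [ab0|[a0|b0]].
  - by case: (leP a 0) => a0; [left|right; rewrite -(pmulr_rle0 _ a0)].
  - by rewrite mulr_le0_ge0 //; lra.
  - by rewrite mulr_ge0_le0 //; lra.
move=> ab; rewrite oppr_le0 mulr_ge0 ?addr_ge0 ?sqr_ge0 //.
by apply/esym; apply: contraNT ab; rewrite negb_or -!ltNge => /andP[a0 b0]; lra.
Qed.

Lemma varphi_eq0 (R : realType) (a b : R) :
  varphi a b = 0 -> [/\ 0 <= a, 0 <= b & a * b = 0].
Proof.
rewrite /varphi; case: ifPn => [ab h|ab /eqP].
  by split=> //; nra.
rewrite oppr_eq0 mulf_eq0 invr_eq0 pnatr_eq0 /= paddr_eq0 ?sqr_ge0 //.
rewrite !sqrf_eq0 => /andP[/eqP a0 /eqP b0].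
by rewrite a0 b0 addr0 lexx in ab.
Qed.

Section Phi.
Context (R : realType) (n kappa : nat).
Variables (F1 F2 : 'rV[R]_n -> 'rV[R]_kappa) (t : R) (x : 'rV[R]_n).
Variable j : 'I_kappa.
Hypotheses (dF1 : differentiable F1 x) (dF2 : differentiable F2 x).

Let a := component F1 j x - t.
Let b := component F2 j x - t.

(** The case [a + b = 0] is included, although there both branches of [varphi] may be met
    arbitrarily close to [x]. *)
Lemma grad_Phi : 0 <= a + b ->
  grad (Phi F1 F2 t j) x =
  b *: grad (component F1 j) x + a *: grad (component F2 j) x.
Proof.
move=> ab; apply/rowP => i; rewrite !mxE; set v := delta_mx 0 i.
have D1 := derivableP (@derivable_component _ _ _ _ _ v j dF1).
have D2 := derivableP (@derivable_component _ _ _ _ _ v j dF2).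
pose u y := let s := component F1 j y - t + (component F2 j y - t) in
  if 0 <= s then 0 else 2^-1 * s ^+ 2.
(* [varphi a b = a * b - min (a + b) 0 ^ 2 / 2], and the correction term is of
   second order at [x]. *)
have -> : Phi F1 F2 t j = (component F1 j - cst t) * (component F2 j - cst t) - u.
  apply/funext => y; rewrite /Phi /varphi /u !fctE.
  by case: ifP => _; [rewrite subr0|field].
have Du : is_derive x v u 0.
  apply: (@is_derive0_sqr_bound _ _ _ (component F1 j + component F2 j)).
    exact: derivableD (ex_derive (is_derive := D1)) (ex_derive (is_derive := D2)).
  move=> y; rewrite /u; set s := _ - t + _; case: ifPn => [_|].
    by rewrite normr0 sqr_ge0.
  (* Since [s < 0 <= a + b], the distance from [s] to [a + b] is at least [|s|], which gives the
     quadratic bound. *)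
  rewrite -ltNge => s_lt0; rewrite ger0_norm; last by rewrite pmulr_rge0 ?invr_gt0 ?sqr_ge0.
  rewrite [X in _ <= X ^+ 2](_ : _ = s - (a + b)); last by rewrite /s /a /b !fctE; ring.
  by nra.
have Dt := is_derive_cst t x v.
rewrite (derive_val (is_derive :=
  is_deriveB (is_deriveM (is_deriveB D1 Dt) (is_deriveB D2 Dt)) Du)).
by rewrite !subr0 addrC.
Qed.

Lemma scale_grad_Phi (m : R) : m * Phi F1 F2 t j x = 0 ->
  m *: grad (Phi F1 F2 t j) x =
  (if j \in H1 F1 F2 t x then (m * b) *: grad (component F1 j) x else 0) +
  (if j \in H2 F1 F2 t x then (m * a) *: grad (component F2 j) x else 0).
Proof.
move/eqP; rewrite mulf_eq0 => /orP[/eqP ->|/eqP P0].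
  by rewrite scale0r !mul0r !scale0r !if_same addr0.
have [a0 b0 /eqP ab] := varphi_eq0 P0.
rewrite grad_Phi; last exact: addr_ge0 a0 b0.
rewrite scalerDr !scalerA !inE -/a -/b.
(* As [a] and [b] are nonnegative, membership in [H1] and [H2] depends only on which of them vanish;
   [a * b = 0] excludes that neither does. *)
rewrite -!(subr_eq0 _ t) -!(subr_gt0 t) -/a -/b !lt_def a0 b0 !andbT.
by move: ab; rewrite mulf_eq0;
  have [->|an0] := eqVneq a 0; have [->|bn0] := eqVneq b 0;
  rewrite //= ?mulr0 ?scale0r ?addr0 ?add0r.
Qed.

End Phi.

Theorem proposition2 (R : realType) (n kappa : nat)
    (f : 'rV[R]_n -> R) (F1 F2 : 'rV[R]_n -> 'rV[R]_kappa) (t : R)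
    (hf : Ck 2 f) (hF1 : Ck 2 F1) (hF2 : Ck 2 F2) (ht : 0 < t)
    (x : 'rV[R]_n) :
  KS_KKT f F1 F2 t x <-> D_S_stationary f F1 F2 t x.
Proof.
have [[/(_ x) dF1 _] [/(_ x) dF2 _]] := (hF1, hF2).
have feasE : KS_feasible F1 F2 t x <-> D_feasible F1 F2 t x.
  by split=> H j; have := H j; rewrite /Phi varphi_le0 !opprB.
split=> -[/feasE Fx].
  move=> [mu [mu1 [mu2 [mu_ge0 gradf compl]]]]; split=> //.
  exists (fun=> 0), (fun=> 0), (fun j => mu j * (component F2 j x - t)),
    (fun j => mu j * (component F1 j x - t)), mu1, mu2; split=> //.
  - split=> j; rewrite inE => /andP[].
      by move=> _ tF; have [? _ _] := mu_ge0 j; rewrite mulr_ge0 // subr_ge0 ltW.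
    by move=> tF _; have [? _ _] := mu_ge0 j; rewrite mulr_ge0 // subr_ge0 ltW.
  - by split=> j _; have [] := mu_ge0 j.
  - rewrite gradf [X in - X - _ - _]big1 => [|j _]; last by rewrite !scale0r addr0.
    rewrite oppr0 add0r -opprD; congr (- _ + _ + _).
    + rewrite !(big_mkcond (fun j => j \in _)) -big_split; apply: eq_bigr => j _ /=.
      by rewrite scale_grad_Phi //; case: (compl j).
    (* Complementarity forces [mu1 j = 0] off [N1], so the full sum reduces to the one over [N1]. *)
    + rewrite [RHS]big_mkcond; apply: eq_bigr => j _; rewrite inE.
      by case: eqVneq => // F0; have [_ /eqP + _] := compl j;
        rewrite mulf_eq0 (negPf F0) orbF => /eqP ->; rewrite scale0r.
    + rewrite [RHS]big_mkcond; apply: eq_bigr => j _; rewrite inE.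
      by case: eqVneq => // F0; have [_ _ /eqP] := compl j;
        rewrite mulf_eq0 (negPf F0) orbF => /eqP ->; rewrite scale0r.
move=> [zeta1 [zeta2 [eta1 [eta2 [nu1 [nu2 [zeta0 [eta1_ge0 eta2_ge0] [nu1_ge0 nu2_ge0]]]]]]]] gradf.
split=> //.
(* This inverts the previous passage from [mu] to the [eta]s: the divisors are positive on [H1] and
   [H2], and these sets are disjoint, so the order of the tests is immaterial. *)
pose mu j := if j \in H1 F1 F2 t x then eta1 j / (component F2 j x - t)
  else if j \in H2 F1 F2 t x then eta2 j / (component F1 j x - t) else 0.
have compl j : mu j * Phi F1 F2 t j x = 0.
  rewrite /mu /Phi /varphi !inE.
  case: ifPn => [/andP[/eqP -> tF]|_].
    by rewrite subrr add0r subr_ge0 ltW // mul0r mulr0.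
  case: ifPn => [/andP[tF /eqP ->]|_]; last by rewrite mul0r.
  by rewrite subrr addr0 subr_ge0 ltW // !mulr0.
(* Off [N1] and [N2] the given multipliers are arbitrary; cutting them to 0 there secures both sign
   and complementarity. *)
exists mu, (fun j => if j \in N1 F1 x then nu1 j else 0),
  (fun j => if j \in N2 F2 x then nu2 j else 0); split.
- move=> j; split.
  + rewrite /mu; case: ifPn => [jH1|_].
      rewrite divr_ge0 ?eta1_ge0 //; move: jH1; rewrite inE subr_ge0.
      by move=> /andP[_ /ltW].
    case: ifPn => [jH2|//].
    rewrite divr_ge0 ?eta2_ge0 //; move: jH2; rewrite inE subr_ge0.
    by move=> /andP[/ltW].
  + by case: ifPn => // /nu1_ge0.
  + by case: ifPn => // /nu2_ge0.
- rewrite gradf [X in - X - _ - _]big1 => [|j /zeta0[-> ->]]; last first.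
    by rewrite !scale0r addr0.
  rewrite oppr0 add0r -opprD; congr (- _ + _ + _).
  + rewrite !(big_mkcond (fun j => j \in _)) -big_split; apply: eq_bigr => j _ /=.
    rewrite scale_grad_Phi //; congr (_ + _); case: ifPn => // jH.
      rewrite /mu jH divfK //; move: jH; rewrite inE subr_eq0 => /andP[_].
      by move=> /gt_eqF ->.
    have jH1 : j \notin H1 F1 F2 t x.
      by move: jH; rewrite !inE => /andP[/gt_eqF -> _].
    rewrite /mu (negPf jH1) jH divfK //; move: jH; rewrite inE subr_eq0.
    by move=> /andP[/gt_eqF ->].
  + by rewrite big_mkcond; apply: eq_bigr => j _; case: ifP; rewrite ?scale0r.
  + by rewrite big_mkcond; apply: eq_bigr => j _; case: ifP; rewrite ?scale0r.
- move=> j; split; rewrite ?compl // inE.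
    by case: eqP => [->|_]; rewrite ?mulr0 ?mul0r.
  by case: eqP => [->|_]; rewrite ?mulr0 ?mul0r.
Qed.
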